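(* Let $G$ be an $n$-vertex graph and $k \in \mathbb{N}$. For each $j \in \mathbb{N}$, let $c_j$ denote a uniformly random $j$-coloring of $G$. If $\mathbb{P}[c_{k+1} \text{ is proper}] < \mathbb{P}[c_{k} \text{ is proper}]$, then $P_{\ell}(G,k) < P(G,k)$.
   Context: All graphs are finite, simple, and nonempty (at least one vertex). $\mathbb{N}$ denotes the set of positive integers and $[k]=\{1,\ldots,k\}$. A (not necessarily proper) $k$-coloring of $G$ is an arbitrary function $f: V(G) \to [k]$; a uniformly random $k$-coloring is chosen uniformly among all $k^n$ such functions, where $n=|V(G)|$ (equivalently, each vertex is colored independently and uniformly with a color from $[k]$). A $k$-coloring $f$ is proper if $f(u) \neq f(v)$ whenever $uv \in E(G)$; $P(G,k)$ denotes the number of proper $k$-colorings of $G$. A list assignment $L$ of $G$ assigns to each $v \in V(G)$ a set $L(v)$ of colors; it is a $k$-assignment if $|L(v)| = k$ for every $v$. A proper $L$-coloring is a function $f$ on $V(G)$ with $f(v) \in L(v)$ for every $v$ and $f(u) \neq f(v)$ whenever $uv \in E(G)$. $P(G,L)$ is the number of proper $L$-colorings of $G$, and $P_{\ell}(G,k)$ is the minimum of $P(G,L)$ over all $k$-assignments $L$ of $G$. *)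

(* Defs.v *)
From mathcomp Require Import all_boot all_order all_algebra.
From mathcomp Require Import finmap boolp.

Set Implicit Arguments.
Unset Strict Implicit.
Unset Printing Implicit Defensive.

Import GRing.Theory Num.Theory.

Record graph := Graph {
  vertex :> finType;
  adj : rel vertex;
  adj_sym : symmetric adj;
  adj_irr : irreflexive adj;
  vertex_gt0 : 0 < #|vertex| }.

Definition proper (G : graph) (C : eqType) (f : G -> C) : bool :=
  [forall u : G, forall v : G, adj u v ==> (f u != f v)].

(* The elements 0, ..., k - 1 of 'I_k play the role of the colors 1, ..., k. *)
Definition coloring (G : graph) (k : nat) := {ffun G -> 'I_k}.

Definition num_col (G : graph) (k : nat) : nat :=
  #|[set f : coloring G k | proper f]|.

(* Colors range over the infinite set nat, so that lists at distinct vertices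
   may overlap arbitrarily or not at all. *)
Definition list_assignment (G : graph) := G -> {fset nat}.

Definition k_assignment (G : graph) (k : nat) (L : list_assignment G) : Prop :=
  forall v : G, #|` L v| = k.

Definition list_coloring (G : graph) (L : list_assignment G) :=
  {dffun forall v : G, L v}.

Definition num_list_col (G : graph) (L : list_assignment G) : nat :=
  #|[set f : list_coloring L | proper (fun v : G => val (f v))]|.

Definition list_col_value (G : graph) (k : nat) : pred nat := fun m =>
  `[< exists L : list_assignment G, k_assignment k L /\ num_list_col L = m >].

Lemma list_col_value_ex (G : graph) (k : nat) :
  exists m, list_col_value G k m.
Proof.
pose L : list_assignment G := fun=> [fset i in iota 0 k]%fset.
exists (num_list_col L); apply/asboolP; exists L; split=> // v.
by rewrite card_fseq undup_id ?iota_uniq // size_iota.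
Qed.

Definition min_list_col (G : graph) (k : nat) : nat :=
  ex_minn (list_col_value_ex G k).

Local Open Scope ring_scope.

Definition uniform (S : finType) : S -> rat := fun=> #|S|%:R^-1.

Definition Pr (S : finType) (mu : S -> rat) (A : pred S) : rat :=
  \sum_(x : S | A x) mu x.

Definition prob_proper (G : graph) (j : nat) : rat :=
  Pr (@uniform (coloring G j)) (fun c => proper c).

(* Main.v *)
From mathcomp Require Import all_boot all_order all_algebra.
From mathcomp Require Import finmap boolp.
Require Import Defs.

(** The argument is a first-moment computation.  Delete from the palette
    [{0, ..., k}] one colour [g v] at each vertex [v], the deleted colours being
    independent and uniform.  A fixed proper (k+1)-colouring [f] survives, that
    is, [f v] is never the colour deleted at [v], with probability
    (k / (k+1))^n, so the expected number of proper list colourings is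
    P(G, k+1) k^n / (k+1)^n.  The hypothesis on the probabilities says precisely
    that this mean is below P(G, k), hence some choice of deletions, which is a
    k-assignment, has fewer than P(G, k) proper list colourings.

    Probabilities are cleared of denominators: [sum_num_avoiding] is the double
    count giving the mean, and [num_list_col_deletion_le] compares the colourings
    from the lists with the (k+1)-colourings that avoid [g]. *)

Set Implicit Arguments.
Unset Strict Implicit.
Unset Printing Implicit Defensive.

Import GRing.Theory Num.Theory.

Lemma min_list_col_le (G : graph) (k : nat) (L : list_assignment G) :
  k_assignment k L -> min_list_col G k <= num_list_col L.
Proof.
move=> Lk; rewrite /min_list_col; case: ex_minnP => m _; apply.
by apply/asboolP; exists L.
Qed.

Lemma prob_proper_ratio (G : graph) (j : nat) :
  prob_proper G j = ((num_col G j)%:R / (j ^ #|G|)%:R)%R.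
Proof.
rewrite /prob_proper /Pr /uniform sumr_const card_ffun card_ord -[LHS]mulr_natl.
by congr (_%:R * _)%R; apply: eq_card => f; rewrite inE.
Qed.

Lemma prob_proper_lt (G : graph) (i j : nat) : 0 < i -> 0 < j ->
  (prob_proper G i < prob_proper G j)%R ->
  num_col G i * j ^ #|G| < num_col G j * i ^ #|G|.
Proof.
move=> i0 j0; rewrite !prob_proper_ratio.
rewrite ltr_pdivrMr ?ltr0n ?expn_gt0 ?i0 //.
rewrite mulrAC ltr_pdivlMr ?ltr0n ?expn_gt0 ?j0 //.
by rewrite -!natrM ltr_nat.
Qed.

Section ColorDeletion.

Variables (G : graph) (k : nat).
Implicit Types f g : coloring G k.+1.

Definition deletion g : list_assignment G :=
  fun v => [fset i in rem (g v : nat) (iota 0 k.+1)]%fset.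

Definition avoids f g : bool := [forall v, f v != g v].

Lemma deletion_k_assignment g : k_assignment k (deletion g).
Proof.
move=> v; rewrite card_fseq undup_id ?rem_uniq ?iota_uniq //.
by rewrite size_rem ?size_iota // mem_iota ltn_ord.
Qed.

Lemma mem_deletion g v (i : nat) :
  (i \in deletion g v) = (i != g v) && (i < k.+1).
Proof. by rewrite in_fset mem_rem_uniq ?iota_uniq // inE mem_iota. Qed.

(** The lists lie in [{0, ..., k}], so a list colouring can be read, without loss,
    as a (k+1)-colouring; list membership then becomes avoidance of [g]. *)
Lemma num_list_col_deletion_le g :
  num_list_col (deletion g) <=
    #|[set f : coloring G k.+1 | proper f && avoids f g]|.
Proof.
pose widen (h : list_coloring (deletion g)) : coloring G k.+1 :=
  [ffun v => inord (val (h v))].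
have widenE h v : widen h v = val (h v) :> nat.
  have := valP (h v); rewrite mem_deletion ffunE => /andP[_ lt_hv].
  by rewrite inordK.
have widen_inj : injective widen.
  by move=> h h' eq_hh'; apply/ffunP => v; apply: val_inj; rewrite -!widenE eq_hh'.
rewrite /num_list_col -(card_imset _ widen_inj).
apply/subset_leq_card/subsetP => _ /imsetP[h + ->]; rewrite !inE => h_proper.
apply/andP; split.
  apply/forallP => u; apply/forallP => v.
  by have /forallP/(_ u)/forallP/(_ v) := h_proper; rewrite -val_eqE /= !widenE.
apply/forallP => v; have := valP (h v); rewrite mem_deletion => /andP[+ _].
by rewrite -val_eqE /= widenE.
Qed.

Lemma card_avoids f : #|[set g | avoids f g]| = k ^ #|G|.
Proof.
have -> : #|[set g | avoids f g]| = #|family (fun v => predC1 (f v))|.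
  apply: eq_card => g; rewrite inE.
  by apply: eq_forallb => v; rewrite inE eq_sym.
rewrite card_family foldrE big_map big_enum /= -prod_nat_const.
by apply: eq_big => // v _; rewrite cardC1 card_ord.
Qed.

Lemma sum_num_avoiding :
  \sum_g #|[set f : coloring G k.+1 | proper f && avoids f g]| =
  num_col G k.+1 * k ^ #|G|.
Proof.
under eq_bigr => g _ do rewrite -sum1dep_card big_mkcondr /=.
rewrite exchange_big /= /num_col -sum_nat_const.
apply: eq_big => [f|f _]; first by rewrite inE.
by rewrite -big_mkcond sum1dep_card card_avoids.
Qed.

End ColorDeletion.

Theorem corollary5 (G : graph) (n : nat) (hn : #|G| = n) (k : nat)
    (hk : (0 < k)%N) :
  (prob_proper G k.+1 < prob_proper G k)%R ->
  (min_list_col G k < num_col G k)%N.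
Proof.
move/(prob_proper_lt (ltn0Sn k) hk); apply: contraTltn => le_col_min.
rewrite -leqNgt -sum_num_avoiding mulnC.
have <- : #|{: coloring G k.+1}| = k.+1 ^ #|G| by rewrite card_ffun card_ord.
rewrite -sum_nat_const; apply: leq_sum => g _.
apply: leq_trans (num_list_col_deletion_le g).
exact: leq_trans le_col_min (min_list_col_le (deletion_k_assignment g)).
Qed.
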